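(* Let $l\ge 1$, and let $n_1,\dots,n_l$ be positive integers with $N=n_1+\cdots+n_l$. For each $j\in\{1,\dots,l\}$, let $\mu_j$ be a probability measure on $\{0,1\}^{n_j}$ which is either a $k_j$-out-of-$n_j$ measure $P_{k_j,n_j}$ for some integer $0\le k_j\le n_j$, or a weighted $k_j$-out-of-$n_j$ measure $P^{w^{(j)}}_{k_j,n_j}$ for some integer $1\le k_j\le n_j$ and some vector $w^{(j)}=(w^{(j)}_1,\dots,w^{(j)}_{n_j})$ of non-negative real numbers at least $k_j$ of which are positive. Let $\mu=\mu_1\times\cdots\times\mu_l$ be the product measure, viewed as a probability measure on $\{0,1\}^N=\{0,1\}^{n_1}\times\cdots\times\{0,1\}^{n_l}$. Then for all increasing events $A,B\subset\{0,1\}^N$, $$\mu(A\,\square\,B)\le\mu(A)\,\mu(B).$$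
   Context: For a positive integer $n$, let $[n]=\{1,\dots,n\}$. For $\omega\in\{0,1\}^n$ and $S\subset[n]$, write $\omega_S=(\omega_i)_{i\in S}$ and $[\omega]_S=\{\alpha\in\{0,1\}^n:\alpha_S=\omega_S\}$. For $A,B\subset\{0,1\}^n$, define $$A\,\square\,B=\{\omega\in\{0,1\}^n:\ \text{there exist disjoint } K,L\subset[n]\text{ such that }[\omega]_K\subset A\text{ and }[\omega]_L\subset B\}.$$ For $\omega,\omega'\in\{0,1\}^n$, write $\omega'\ge\omega$ if $\omega'_i\ge\omega_i$ for all $i\in[n]$. An event $A\subset\{0,1\}^n$ is increasing if $\omega'\in A$ whenever $\omega\in A$ and $\omega'\ge\omega$. Let $\Omega_{k,n}$ be the set of all $\omega\in\{0,1\}^n$ with exactly $k$ coordinates equal to $1$. The $k$-out-of-$n$ measure $P_{k,n}$ is the probability measure on $\{0,1\}^n$ that assigns equal probability to all $\omega\in\Omega_{k,n}$ and probability $0$ to all other elements. For $w=(w_1,\dots,w_n)$ with non-negative entries, at least $k$ of them positive, the weighted $k$-out-of-$n$ measure $P^w_{k,n}$ is the probability measure on $\{0,1\}^n$ given by $$P^w_{k,n}(\omega)=C\,\mathrm{I}(\omega\in\Omega_{k,n})\prod_{i=1}^n w_i^{\omega_i},$$ where $\mathrm{I}$ is the indicator function, $0^0=1$, and $C$ is the normalizing constant making $P^w_{k,n}$ a probability measure. *)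

(* Defs.v *)
From mathcomp Require Import all_boot all_order all_algebra.
From mathcomp Require Import reals.
Set Implicit Arguments.
Unset Strict Implicit.
Unset Printing Implicit Defensive.
Import Order.TTheory GRing.Theory Num.Theory.
Local Open Scope ring_scope.

(* Coordinates are numbered from 0: 'I_n = {0, ..., n-1} stands for [n]. *)
Notation cube n := {ffun 'I_n -> bool}.

Definition cylinder n (omega : cube n) (S : {set 'I_n}) : {set cube n} :=
  [set alpha : cube n | [forall i in S, alpha i == omega i]].

Definition box n (A B : {set cube n}) : {set cube n} :=
  [set omega : cube n |
    [exists K : {set 'I_n}, exists L : {set 'I_n},
      [&& [disjoint K & L], cylinder omega K \subset A
        & cylinder omega L \subset B]]].

(* The booleans are compared through their coercion to {0, 1}. *)
Definition increasing n (A : {set cube n}) : Prop :=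
  forall omega omega' : cube n,
    omega \in A -> (forall i, (omega i <= omega' i)%N) -> omega' \in A.

Definition Omega (k n : nat) : {set cube n} :=
  [set omega : cube n | #|[set i | omega i]| == k].

(* A probability measure on a finite type, given by its values on points. *)
Record prob (R : realType) (T : finType) := Prob {
  pmf :> T -> R;
  pmf_ge0 : forall x, 0 <= pmf x;
  pmf_sum1 : \sum_x pmf x = 1
}.

Definition Pr (R : realType) (T : finType) (mu : prob R T) (A : {set T}) : R :=
  \sum_(x in A) mu x.

Definition k_out_of_n_pmf (R : realType) (n k : nat) (omega : cube n) : R :=
  (omega \in Omega k n)%:R / #|Omega k n|%:R.

(* w i ^+ omega i uses the coercion bool >-> nat, and x ^+ 0 = 1 also for
   x = 0. *)
Definition weight (R : realType) (n k : nat) (w : 'I_n -> R)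
    (omega : cube n) : R :=
  (omega \in Omega k n)%:R * \prod_(i < n) w i ^+ omega i.

Definition weighted_k_out_of_n_pmf (R : realType) (n k : nat) (w : 'I_n -> R)
    (omega : cube n) : R :=
  (\sum_(alpha : cube n) weight k w alpha)^-1 * weight k w omega.

Lemma Omega_neq0 n (P : {set 'I_n}) k : (k <= #|P|)%N ->
  exists2 omega : cube n, omega \in Omega k n & forall i, omega i -> i \in P.
Proof.
move=> kP; have [K KP cK] : exists2 K : {set 'I_n}, K \subset P & #|K| = k.
  have : (0 < #|[set K : {set 'I_n} | (K \subset P) && (#|K| == k)]|)%N.
    by rewrite cards_draws bin_gt0.
  by case/card_gt0P=> K; rewrite inE => /andP[KP /eqP cK]; exists K.
exists ([ffun i => i \in K] : cube n).
  rewrite inE; apply/eqP; rewrite -cK; apply: eq_card => i.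
  by rewrite inE ffunE.
by move=> i; rewrite ffunE => /(subsetP KP).
Qed.

Lemma k_out_of_n_ge0 (R : realType) n k omega :
  0 <= @k_out_of_n_pmf R n k omega.
Proof. by rewrite divr_ge0 ?ler0n. Qed.

Lemma k_out_of_n_sum1 (R : realType) n k : (k <= n)%N ->
  \sum_omega @k_out_of_n_pmf R n k omega = 1.
Proof.
move=> kn; have [|omega om _] := @Omega_neq0 n setT k.
  by rewrite cardsT card_ord.
rewrite -mulr_suml -natr_sum -big_mkcond /= sum1_card divff //.
by rewrite pnatr_eq0 -lt0n; apply/card_gt0P; exists omega.
Qed.

Definition k_out_of_n (R : realType) n k (kn : (k <= n)%N) : prob R (cube n) :=
  Prob (@k_out_of_n_ge0 R n k) (k_out_of_n_sum1 R kn).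

Lemma weight_ge0 (R : realType) n k (w : 'I_n -> R) omega :
  (forall i, 0 <= w i) -> 0 <= weight k w omega.
Proof.
by move=> w0; rewrite mulr_ge0 ?ler0n // prodr_ge0 // => i _; rewrite exprn_ge0.
Qed.

Lemma weighted_k_out_of_n_ge0 (R : realType) n k (w : 'I_n -> R) omega :
  (forall i, 0 <= w i) -> 0 <= weighted_k_out_of_n_pmf k w omega.
Proof.
move=> w0; rewrite mulr_ge0 ?weight_ge0 // invr_ge0 sumr_ge0 // => ? _.
exact: weight_ge0.
Qed.

Lemma weighted_k_out_of_n_sum1 (R : realType) n k (w : 'I_n -> R) :
  (forall i, 0 <= w i) -> (k <= #|[set i | (0 < w i)%R]|)%N ->
  \sum_omega weighted_k_out_of_n_pmf k w omega = 1.
Proof.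
move=> w0 /Omega_neq0[omega om wpos]; rewrite -mulr_sumr mulVf //.
rewrite gt_eqF // (bigD1 omega) //= ltr_wpDr //.
  by rewrite sumr_ge0 // => ? _; apply: weight_ge0.
rewrite /weight om mul1r prodr_gt0 // => i _.
case e: (omega i); last by rewrite expr0.
by move: (wpos i e); rewrite inE expr1.
Qed.

Definition weighted_k_out_of_n (R : realType) n k (w : 'I_n -> R)
    (w0 : forall i, 0 <= w i) (wk : (k <= #|[set i | (0 < w i)%R]|)%N) :
    prob R (cube n) :=
  Prob (fun omega => weighted_k_out_of_n_ge0 k omega w0)
       (weighted_k_out_of_n_sum1 w0 wk).

Definition is_k_out_of_n (R : realType) (n : nat) (mu : prob R (cube n)) : Prop :=
  exists (k : nat) (kn : (k <= n)%N), mu =1 k_out_of_n R kn.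

Definition is_weighted_k_out_of_n (R : realType) (n : nat)
    (mu : prob R (cube n)) : Prop :=
  exists (k : nat) (w : 'I_n -> R) (w0 : forall i, 0 <= w i)
         (wk : (k <= #|[set i | (0 < w i)%R]|)%N),
    (1 <= k <= n)%N /\ mu =1 weighted_k_out_of_n w0 wk.

(* {0,1}^N with N = n_0 + ... + n_(l-1) is identified with the product of the
   {0,1}^(n_j) by concatenation: @tagnat.Rank l n j i is the index
   n_0 + ... + n_(j-1) + i. *)
Definition block l (n : 'I_l -> nat) (j : 'I_l)
    (omega : cube (\sum_(i < l) n i)) : cube (n j) :=
  [ffun i => omega (@tagnat.Rank l n j i)].

Definition product_pmf (R : realType) l (n : 'I_l -> nat)
    (mu : forall j, prob R (cube (n j)))
    (omega : cube (\sum_(j < l) n j)) : R :=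
  \prod_(j < l) mu j (block j omega).

Lemma product_ge0 (R : realType) l (n : 'I_l -> nat)
    (mu : forall j, prob R (cube (n j))) omega : 0 <= product_pmf mu omega.
Proof. by rewrite prodr_ge0 // => j _; apply: pmf_ge0. Qed.

Lemma product_sum1 (R : realType) l (n : 'I_l -> nat)
    (mu : forall j, prob R (cube (n j))) :
  \sum_omega product_pmf mu omega = 1.
Proof.
pose P j : {ffun cube (n j) -> R} := [ffun x => mu j x].
transitivity (\sum_(t : fprod (fun j => cube (n j))) \prod_(j in 'I_l) P j (t j)).
  pose h (omega : cube (\sum_(j < l) n j)) :=
    [fprod j : 'I_l => block j omega].
  pose g (t : fprod (fun j => cube (n j))) : cube (\sum_(j < l) n j) :=
    [ffun s => t (tagnat.sig1 s) (tagnat.sig2 s)].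
  rewrite (reindex h) /=; last first.
    exists g => [omega _ | t _].
      by apply/ffunP => s; rewrite ffunE fprodE ffunE tagnat.sig2K.
    apply/fprodP => j; rewrite fprodE; apply/ffunP => i; rewrite !ffunE.
    rewrite /tagnat.sig1 /tagnat.sig2 /tagnat.Rank.
    by rewrite tagnat.rankK.
  apply: eq_bigr => omega _; apply: eq_bigr => j _.
  by rewrite ffunE fprodE.
rewrite big_fprod.
rewrite -(bigA_distr_big_dep _ (fun j u => untag 0 (P j) u)) big1 // => j _.
transitivity (\sum_(x : cube (n j)) P j x).
  exact/esym/(big_tag (fun j => P j : cube (n j) -> R)).
by rewrite -(pmf_sum1 (mu j)); apply: eq_bigr => x _; rewrite ffunE.
Qed.

Definition product (R : realType) l (n : 'I_l -> nat)
    (mu : forall j, prob R (cube (n j))) : prob R (cube (\sum_(j < l) n j)) :=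
  Prob (product_ge0 mu) (product_sum1 mu).

(* Main.v *)
Require Import Defs.
From mathcomp Require Import all_boot all_order all_algebra.
From mathcomp Require Import perm.
From mathcomp Require Import reals.
Import Order.TTheory GRing.Theory Num.Theory.
Local Open Scope ring_scope.
Set Implicit Arguments.
Unset Strict Implicit.
Unset Printing Implicit Defensive.

(** The product measure has the form m(u) = C [u has k_j ones in block j, for
    all j] prod_i w_i^(u_i), by [product_block_weight]. Since C sum_v m(v) = 1,
    the claim follows from an inequality between two sums over pairs (u, v) of
    configurations: the weight m(u) m(v) over the pairs with u in the box is at
    most the same weight over the pairs with u in A and v in B.

    Fix the block structure and consider two configurations u, v with the same
    number of ones in every block. The coordinates where u and v differ can be
    matched, inside each block, into pairs on which u takes both values
    ([pairing_exists]); such a matching is an involution pi, and v is u read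
    through pi. Choosing pi uniformly among the admissible ones turns the double
    sum over (u, v) into a sum over (u, pi) ([sum_over_pairings]). With pi
    fixed, exchanging the two values on any set of pairs of pi changes neither
    m(u) m(v) nor the number of admissible involutions, so one may average over
    these exchanges. They are indexed by a full discrete cube, where exchanging
    on the complementary set of pairs amounts to passing from u to v. It remains
    to count points of that cube ([box_swap_bound]). Every pair of pi carries a
    single one; as A and B are increasing, disjoint sets of ones certifying
    membership in A and in B therefore use disjoint sets of pairs, and the
    counting inequality is the combinatorial core of Reimer's theorem
    ([butterfly_bound]): if every x in a set S of points of a cube carries a set
    K(x) of coordinates, then at least #|S| points y agree with some x in S on
    K(x) while their complement agrees with some x in S off K(x).

    The proof of [butterfly_bound] is linear algebra in the tensor power of
    F^2, for F the rationals. To x in S attach the tensor with factor e_(x_i)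
    for i in K(x) and e_(x_i) + t e_(1-x_i) for the other i. To a point z not
    counted on the right attach either the basis tensor e_z, when z agrees with
    no x in S on K(x), or the product of the e_(z_i) - t^(-1) e_(1-z_i). Any
    vector of the first kind is orthogonal to any vector of the second kind,
    since one factor vanishes. Both families extend to families indexed by the
    whole cube whose determinants are polynomials in t, resp. -t^(-1), with
    value 1 at 0 ([det_twist]); hence for a suitable t both families are
    independent, and their sizes add up to at most the size of the cube. *)

(** * Reimer's butterfly inequality *)

Definition agree (I : finType) (x y : {ffun I -> bool}) (J : {set I}) :=
  [forall i in J, y i == x i].
Definition flip (I : finType) (x : {ffun I -> bool}) : {ffun I -> bool} :=
  [ffun i => ~~ x i].

(** The coordinate at y of the tensor attached to x: the i-th factor is
    e_(x_i) + s e_(1 - x_i) when i is in the mask of x, and e_(x_i) otherwise.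
    *)
Definition twist_entry (I : finType) (F : pzRingType)
    (mask : {ffun I -> bool} -> {set I}) (s : F) (x y : {ffun I -> bool}) : F :=
  \prod_i (if x i == y i then 1 else if i \in mask x then s else 0).

Definition twist (I : finType) (F : pzRingType)
    (mask : {ffun I -> bool} -> {set I}) (s : F) : 'M[F]_#|{ffun I -> bool}| :=
  \matrix_(a, b) twist_entry mask s (enum_val a) (enum_val b).

(** At s = 0 the twisted matrix is the identity, whatever the masks are. *)
Lemma det_twist (I : finType) (F : comNzRingType)
    (mask : {ffun I -> bool} -> {set I}) :
  exists2 p : {poly F}, p != 0 & forall s, p.[s] = \det (twist mask s).
Proof.
have evalE s : (\det (twist mask ('X : {poly F}))).[s] = \det (twist mask s).
  rewrite -/(horner_eval s _) -det_map_mx; congr (\det _).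
  apply/matrixP => a b; rewrite !mxE /twist_entry rmorph_prod.
  apply: eq_bigr => i _ /=.
  case: ifP => _; first by rewrite rmorph1.
  by case: ifP => _; rewrite ?rmorph0 // /horner_eval hornerX.
exists (\det (twist mask 'X)) => //.
suff -> : \det (twist mask ('X : {poly F})) != 0 by [].
apply/eqP => d0; have := evalE 0; rewrite d0 horner0.
have -> : twist mask (0 : F) = 1%:M.
  apply/matrixP => a b; rewrite !mxE /twist_entry; case: eqVneq => [-> | ab].
    by rewrite big1 // => i _; rewrite eqxx.
  have /existsP[i xi] :
      [exists i, (enum_val a : {ffun I -> bool}) i != enum_val b i].
    rewrite -negb_forall; apply: contra ab => /forallP e.
    by apply/eqP/enum_val_inj/ffunP => i; apply/eqP.
  by rewrite (bigD1 i) //= (negPf xi) if_same mul0r.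
by rewrite det1 => /esym/eqP; rewrite oner_eq0.
Qed.

(** Among the first deg p + deg q + 2 positive integers t, fewer than that many
    can be roots of p or have - 1/t as a root of q. *)
Lemma common_nonroot (F : numFieldType) (p q : {poly F}) : p != 0 -> q != 0 ->
  exists2 t : F, t != 0 & p.[t] != 0 /\ q.[- t^-1] != 0.
Proof.
move=> p0 q0.
pose s := [seq (k.+1%:R : F) | k <- iota 0 (size p + size q)].
have us : uniq s.
  rewrite map_inj_uniq ?iota_uniq // => i j /eqP.
  by rewrite eqr_nat => /eqP[].
have s0 t : t \in s -> t != 0 by case/mapP => k _ ->; rewrite pnatr_eq0.
pose f (t : F) := - t^-1.
have f_inj : injective f by move=> x y /oppr_inj/invr_inj.
case: (boolP (has (fun t => ~~ root p t && ~~ root q (f t)) s)).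
  case/hasP=> t ts /andP[pt qt]; exists t; first exact: s0.
  by split.
rewrite -all_predC => /allP bad.
have hp := count_predUI (root p) (preim f (root q)) s.
have ha : count (predU (root p) (preim f (root q))) s = size s.
  apply/eqP; rewrite -all_count; apply/allP => t /bad /=.
  by rewrite negb_and !negbK.
have cp : (count (root p) s < size p)%N.
  rewrite -size_filter; apply: max_poly_roots => //; first exact: filter_all.
  exact: filter_uniq.
have cq : (count (preim f (root q)) s < size q)%N.
  rewrite -size_filter -(size_map f).
  apply: max_poly_roots => //; last by rewrite map_inj_uniq // filter_uniq.
  by rewrite all_map; apply: filter_all.
have : (size s <= count (root p) s + count (preim f (root q)) s)%N.
  by rewrite -ha -hp leq_addr.
rewrite size_map size_iota leqNgt => /negP[].
by rewrite -addSn leq_add // ltnW.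
Qed.

Lemma mxrank_rowsub_unit (F : fieldType) (n : nat) (M : 'M[F]_n)
    (S : {set 'I_n}) : M \in unitmx ->
  \rank (rowsub (enum_val : 'I_#|S| -> 'I_n) M) = #|S|.
Proof.
move=> Mu; apply/eqP; rewrite -/(row_free _); apply/row_freeP.
exists (invmx M *m (rowsub (enum_val : 'I_#|S| -> 'I_n) 1%:M)^T).
rewrite mulmxA mul_rowsub_mx mulmxV //.
apply/matrixP => a b; rewrite mul_rowsub_mx mul1mx !mxE.
by rewrite (inj_eq enum_val_inj) eq_sym.
Qed.

Lemma orthogonal_rows (F : fieldType) (n : nat) (V W : 'M[F]_n)
    (S T : {set 'I_n}) : V \in unitmx -> W \in unitmx ->
  {in S & T, forall a b, \sum_c V a c * W b c = 0} -> (#|S| + #|T| <= n)%N.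
Proof.
move=> Vu Wu VW.
rewrite -(mxrank_rowsub_unit S Vu) -(mxrank_rowsub_unit T Wu).
rewrite -[X in (_ + X)%N]mxrank_tr; apply: mulmx0_rank_max.
apply/matrixP => a b; rewrite !mxE -[RHS](VW _ _ (enum_valP a) (enum_valP b)).
by apply: eq_bigr => c _; rewrite !mxE.
Qed.

(** The set on the right is the intersection of the red set of the butterflies
    (x, K x) with the reflection of their yellow set. *)
Theorem butterfly_bound (I : finType) (S : {set {ffun I -> bool}})
    (K : {ffun I -> bool} -> {set I}) :
  (#|S| <= #|[set y | [exists x in S, agree x y (K x)]
                    & [exists x in S, agree x (flip y) (~: K x)]]|)%N.
Proof.
set U := [set y | _ & _].
pose red (y : {ffun I -> bool}) := [exists x in S, agree x y (K x)].
pose maskV x := ~: K x.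
pose maskW y : {set I} := if red y then setT else set0.
have [p p0 pE] := det_twist rat maskV.
have [q q0 qE] := det_twist rat maskW.
have [t t0 [pt qt]] := common_nonroot p0 q0.
have ortho x z : x \in S -> z \notin U ->
  \sum_y twist_entry maskV t x y * twist_entry maskW (- t^-1) z y = 0.
  move=> xS zU.
  pose f i b := (if x i == b then 1 else if i \in maskV x then t else 0) *
    (if z i == b then 1 else if i \in maskW z then - t^-1 else 0).
  transitivity (\sum_(y : {ffun I -> bool}) \prod_i f i (y i)).
    by apply: eq_bigr => y _; rewrite -big_split.
  (* The scalar product of two tensors is the product over i of the scalar
     products of their factors, so one orthogonal pair of factors suffices. *)
  rewrite -bigA_distr_bigA.
  suff [i fi] : exists i, \sum_b f i b = 0 by rewrite (bigD1 i) //= fi mul0r.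
  rewrite /f /maskV /maskW; move: zU; rewrite inE -/(red z).
  case: ifP => /= [_ | /existsP nred _].
    (* Here z is red: its flip differs from x at some i off K x, that is
       z i = x i, and the factors there are (1, t) and (1, - 1/t). *)
    move=> /existsP nz.
    have /existsP[i /andP[iK /eqP zx]] :
        [exists i, (i \in ~: K x) && (z i == x i)].
      apply/negP => /existsP nx; case: nz; exists x; rewrite xS.
      apply/forall_inP => i iK; rewrite ffunE; apply/eqP.
      case e : (z i == x i); first by case: nx; exists i; rewrite iK.
      by move: e; case: (z i); case: (x i).
    exists i; rewrite iK zx inE big_bool.
    by case: (x i) => /=; rewrite !(mul1r, mulr1) mulrN divff ?addrN ?addNr.
  (* Here z is not red: z and x differ at some i in K x, where both factors are
     untwisted basis vectors. *)
  have /existsP[i /andP[iK zx]] : [exists i, (i \in K x) && (z i != x i)].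
    apply/negP => /existsP nx; case: nred; exists x; rewrite xS.
    apply/forall_inP => i iK; apply/negPn/negP => zx.
    by case: nx; exists i; rewrite iK.
  exists i; rewrite !inE iK big_bool; move: zx.
  by case: (x i); case: (z i) => //= _; rewrite !(mul0r, mulr0) addr0.
have cardE (A : {set {ffun I -> bool}}) :
    #|@enum_val {ffun I -> bool} {ffun I -> bool} @^-1: A|
    = #|A|.
  rewrite on_card_preimset //; exists enum_rank => a _; first exact: enum_valK.
  exact: enum_rankK.
rewrite -(leq_add2r #|~: U|) cardsC -(cardE S) -(cardE (~: U)).
apply: (@orthogonal_rows rat _ (twist maskV t) (twist maskW (- t^-1))).
- by rewrite unitmxE unitfE -pE.
- by rewrite unitmxE unitfE -qE.
move=> a b; rewrite !inE -/U => aS bU.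
rewrite -[RHS](ortho _ (enum_val b) aS); last by rewrite inE.
rewrite (reindex (@enum_val {ffun I -> bool} {ffun I -> bool})) /=.
  by apply: eq_bigr => c _; rewrite !mxE.
by exists enum_rank => c _; rewrite ?enum_valK ?enum_rankK.
Qed.

(** * Pairings of two configurations with equal block counts *)

Section Pairings.
Variables (T : finType) (L : eqType) (b : T -> L).
Implicit Types (u v x : {ffun T -> bool}) (pi tau : {ffun T -> T}).

Definition relabel u pi : {ffun T -> bool} := [ffun i => u (pi i)].

Lemma relabelE u pi i : relabel u pi i = u (pi i).
Proof. by rewrite ffunE. Qed.

(** The fixed points of pi are the coordinates where u and relabel u pi agree;
    each 2-cycle of pi lies in one block and carries exactly one 1 of u. *)
Definition pairing u pi :=
  [forall i, [&& pi (pi i) == i, b (pi i) == b i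
               & (pi i != i) ==> (u (pi i) != u i)]].

Lemma pairingP u pi :
  reflect [/\ involutive pi, forall i, b (pi i) = b i
            & forall i, pi i != i -> u (pi i) != u i]
          (pairing u pi).
Proof.
apply: (iffP forallP) => [h | [hK hb hu] i].
  by split=> i; have /and3P[/eqP ? /eqP ? /implyP] := h i.
by rewrite hK hb !eqxx; apply/implyP/hu.
Qed.

Definition npairings u v := #|[set pi | pairing u pi & relabel u pi == v]|.

Definition ones u j := #|[set i | (b i == j) && u i]|.

Lemma ones_relabel u tau : involutive tau -> (forall i, b (tau i) = b i) ->
  ones (relabel u tau) =1 ones u.
Proof.
move=> tauK btau j; rewrite /ones -[RHS](card_preimset _ (inv_inj tauK)).
by apply: eq_card => i; rewrite !inE ffunE btau.
Qed.

Lemma relabelK u tau : involutive tau -> relabel (relabel u tau) tau = u.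
Proof. by move=> tauK; apply/ffunP => i; rewrite !ffunE tauK. Qed.

(** Conjugation by tau is a bijection between the two sets of pairings. *)
Lemma npairings_relabel u v tau :
  involutive tau -> (forall i, b (tau i) = b i) ->
  npairings (relabel u tau) (relabel v tau) = npairings u v.
Proof.
move=> tauK btau.
pose conj pi : {ffun T -> T} := [ffun i => tau (pi (tau i))].
have conjK : involutive conj.
  by move=> pi; apply/ffunP => i; rewrite !ffunE !tauK.
rewrite /npairings -[RHS](card_preimset _ (inv_inj conjK)).
apply: eq_card => pi; rewrite !inE; congr (_ && _).
  apply/pairingP/pairingP => -[piK bpi upi]; split=> i.
  - by rewrite !ffunE tauK piK tauK.
  - by rewrite !ffunE btau bpi btau.
  - rewrite ffunE => ne; have := upi (tau i); rewrite !ffunE tauK; apply.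
    by apply: contra ne => /eqP ->; rewrite tauK.
  - by apply: (inv_inj tauK); have := piK (tau i); rewrite !ffunE !tauK.
  - by have := bpi (tau i); rewrite !ffunE tauK !btau.
  move=> ne; have := upi (tau i); rewrite !ffunE tauK; apply.
  by rewrite (inj_eq (inv_inj tauK)).
apply/eqP/eqP => e; apply/ffunP => i.
  by have /ffunP/(_ (tau i)) := e; rewrite !ffunE tauK => <-.
by rewrite -e !ffunE tauK.
Qed.

(** Induction on the number of disagreements: equal counts in a block force a
    disagreement at i to be matched by an opposite one at i' in the same block,
    and exchanging the values of v at i and i' removes both. *)
Lemma pairing_exists u v : ones u =1 ones v ->
  exists2 pi, pairing u pi & relabel u pi = v.
Proof.
have [m le_m] := ubnP #|[set i | u i != v i]|.
elim: m v le_m => // m IH v le_m uv.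
case: (boolP [forall i, u i == v i]) => [/forallP e | /forallPn /= [i ui]].
  exists [ffun i => i].
    by apply/pairingP; split=> i; rewrite !ffunE ?eqxx.
  by apply/ffunP => i; rewrite !ffunE; apply/eqP.
(* If there were none, all disagreements in the block of i would go the same way,
   and one of the two counts would be strictly larger. *)
have [i' [bi' ui' uii']] :
    exists i', [/\ b i' = b i, u i' != v i' & u i' != u i].
  case: (boolP [exists i', [&& b i' == b i, u i' != v i' & u i' != u i]]).
    by case/existsP => i' /and3P[/eqP ? ? ?]; exists i'.
  move=> /existsPn none; have := uv (b i); rewrite /ones.
  move: ui; case ei: (u i) => ui.
    move=> e; suff : (ones v (b i) < ones u (b i))%N by rewrite /ones e ltnn.
    apply: proper_card; apply/properP; split.
      apply/subsetP => k; rewrite !inE => /andP[bk vk]; rewrite bk.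
      by have := none k; rewrite bk vk ei; case: (u k).
    by exists i; rewrite !inE eqxx ?ei //=; move: ui; case: (v i).
  move=> e; suff : (ones u (b i) < ones v (b i))%N by rewrite /ones e ltnn.
  apply: proper_card; apply/properP; split.
    apply/subsetP => k; rewrite !inE => /andP[bk uk]; rewrite bk.
    by have := none k; rewrite bk uk ei; case: (v k).
  by exists i; rewrite !inE eqxx ?ei //=; move: ui; case: (v i).
have ii' : i' != i by apply: contraNneq uii' => ->.
pose tau : {ffun T -> T} := [ffun k => tperm i i' k].
have tauK : involutive tau by move=> k; rewrite !ffunE tpermK.
have btau k : b (tau k) = b k by rewrite ffunE; case: tpermP => [-> | -> |].
have v'i : relabel v tau i = u i.
  by rewrite !ffunE tpermL; move: ui ui' uii';
    case: (u i) (v i) (u i') (v i') => -[] [] [].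
have v'i' : relabel v tau i' = u i'.
  by rewrite !ffunE tpermR; move: ui ui' uii';
    case: (u i) (v i) (u i') (v i') => -[] [] [].
have [||pi /pairingP[piK bpi upi] piE] := IH (relabel v tau).
- rewrite -ltnS; apply: leq_trans le_m; rewrite ltnS.
  apply: proper_card; apply/properP; split.
    apply/subsetP => k; rewrite !inE !ffunE.
    by case: tpermP => [-> | -> |]; rewrite // ?ui ?ui'.
  by exists i; rewrite !inE // v'i eqxx.
- by move=> j; rewrite uv ones_relabel.
(* pi pairs only disagreements of u with the modified v, so it fixes i and i',
   and composing it with the transposition keeps it an involution. *)
have fixi : pi i = i.
  by apply/eqP/negPn/negP => /upi; rewrite -v'i -piE ffunE eqxx.
have fixi' : pi i' = i'.
  by apply/eqP/negPn/negP => /upi; rewrite -v'i' -piE ffunE eqxx.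
have pine k : k != i -> k != i' -> (pi k != i) && (pi k != i').
  move=> ki ki'; apply/andP; split.
    by apply: contra ki => /eqP e; rewrite -[k]piK e fixi.
  by apply: contra ki' => /eqP e; rewrite -[k]piK e fixi'.
exists [ffun k => pi (tau k)].
  apply/pairingP; split=> k; rewrite !ffunE.
  - have [-> | -> | /eqP ki /eqP ki'] := tpermP i i' k.
    + by rewrite fixi' tpermR fixi.
    + by rewrite fixi tpermL fixi'.
    + by have /andP[? ?] := pine _ ki ki'; rewrite tpermD 1?eq_sym ?piK.
  - by rewrite bpi; case: tpermP => [-> | -> |].
  - have [-> | -> | /eqP ki /eqP ki'] := tpermP i i' k; last exact: upi.
      by rewrite fixi'.
    by move=> _; rewrite fixi eq_sym.
rewrite -[v](relabelK v tauK) -piE.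
by apply/ffunP => k; rewrite !ffunE.
Qed.

Lemma npairings_gt0 u v : ones u =1 ones v -> (0 < npairings u v)%N.
Proof.
by case/pairing_exists => pi hpi e; apply/card_gt0P; exists pi;
  rewrite inE hpi e /=.
Qed.

End Pairings.

(** * Exchanging the values on pairs *)

Section Swap.
Variables (T : finType) (L : eqType) (b : T -> L).
Implicit Types (u v : {ffun T -> bool}) (x : {ffun {set T} -> bool}).
Implicit Types (pi : {ffun T -> T}).

(** A pair of pi is represented by the set [set i; pi i], so that the
    choices of the pairs to exchange range over a full discrete cube and no
    representative of a pair has to be selected. *)
Definition pair_swap pi x : {ffun T -> T} :=
  [ffun i => if x [set i; pi i] then pi i else i].

Definition swap pi x u := relabel u (pair_swap pi x).

Lemma pair_swapK pi x : involutive pi -> involutive (pair_swap pi x).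
Proof.
move=> piK i; rewrite !ffunE; case e: (x [set i; pi i]); last by rewrite e.
by rewrite piK setUC e.
Qed.

Lemma pair_swap_pi pi x i : involutive pi ->
  pair_swap pi x (pi i) = pi (pair_swap pi x i).
Proof. by move=> piK; rewrite !ffunE piK setUC; case: ifP. Qed.

Lemma pair_swap_flip pi x i : involutive pi ->
  pair_swap pi (flip x) i = pi (pair_swap pi x i).
Proof. by move=> piK; rewrite !ffunE; case: (x _); rewrite ?piK. Qed.

Lemma swapK pi x : involutive pi -> involutive (swap pi x).
Proof. by move=> piK u; apply/relabelK/pair_swapK. Qed.

Lemma relabel_swap pi x u : involutive pi ->
  relabel (swap pi x u) pi = swap pi x (relabel u pi).
Proof. by move=> piK; apply/ffunP => i; rewrite !relabelE pair_swap_pi. Qed.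

(** Exchanging the complementary set of pairs exchanges the roles of the two
    configurations u and relabel u pi. *)
Lemma swap_flip pi x u : involutive pi ->
  swap pi (flip x) u = relabel (swap pi x u) pi.
Proof.
move=> piK; rewrite relabel_swap //; apply/ffunP => i.
by rewrite !relabelE pair_swap_flip.
Qed.

Lemma b_pair_swap pi x i : (forall i, b (pi i) = b i) ->
  b (pair_swap pi x i) = b i.
Proof. by move=> bpi; rewrite ffunE; case: ifP. Qed.

Lemma pairing_swap pi x u : involutive pi ->
  pairing b (swap pi x u) pi = pairing b u pi.
Proof.
have sub v : pairing b v pi -> pairing b (swap pi x v) pi.
  case/pairingP => piK bpi vpi; apply/pairingP; split=> // i ne.
  rewrite !relabelE pair_swap_pi //.
  by apply: vpi; rewrite -pair_swap_pi // (inj_eq (inv_inj (pair_swapK x piK))).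
move=> piK; apply/idP/idP; last exact: sub.
by move=> /sub; rewrite swapK.
Qed.

End Swap.

(** The inequality butterfly_bound on the cube of exchanges: K x collects the
    pairs that meet the ones of a certificate for A. A certificate for B is
    disjoint from it, and as each pair has a single one, the ones of the
    certificate for B lie in pairs outside K x. *)
Lemma box_swap_bound n (L : eqType) (b : 'I_n -> L) (A B : {set cube n})
    (u : cube n) (pi : {ffun 'I_n -> 'I_n}) :
  increasing A -> increasing B -> pairing b u pi ->
  (#|[set x | swap pi x u \in box A B]| <=
   #|[set x | swap pi x u \in A & relabel (swap pi x u) pi \in B]|)%N.
Proof.
move=> Ainc Binc upi; have [piK _ _] := pairingP _ _ _ upi.
pose fits x (KL : {set 'I_n} * {set 'I_n}) :=
  [&& [disjoint KL.1 & KL.2], cylinder (swap pi x u) KL.1 \subset A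
    & cylinder (swap pi x u) KL.2 \subset B].
pose K (x : {ffun {set 'I_n} -> bool}) : {set {set 'I_n}} :=
  if [pick KL | fits x KL] is Some KL
  then [set [set i; pi i] | i in [set i in KL.1 | swap pi x u i]] else set0.
have KP x : swap pi x u \in box A B -> exists2 KL, fits x KL &
    K x = [set [set i; pi i] | i in [set i in KL.1 | swap pi x u i]].
  rewrite inE => /existsP[K0 /existsP[L0 h]]; rewrite /K.
  case: pickP => [KL hKL | /(_ (K0, L0))]; first by exists KL.
  by rewrite /fits h.
(* Keeping the pairs that carry the ones of a certificate J keeps these ones,
   and an increasing event only needs them. *)
have inc (C : {set cube n}) (x y : {ffun {set 'I_n} -> bool}) (J : {set 'I_n}) :
    increasing C ->
    cylinder (swap pi x u) J \subset C ->
    (forall i, i \in J -> swap pi x u i -> y [set i; pi i] = x [set i; pi i]) ->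
    swap pi y u \in C.
  move=> Cinc /subsetP JC yx.
  apply: (Cinc [ffun i => (i \in J) && swap pi x u i]).
    by apply: JC; rewrite inE; apply/forall_inP => i iJ; rewrite ffunE iJ.
  move=> i; rewrite ffunE; case: (boolP (i \in J)) => //= iJ.
  case e: (swap pi x u i) => //.
  by move: (e); rewrite !ffunE -(yx _ iJ e) => ->.
apply: leq_trans (butterfly_bound _ K) _; apply: subset_leq_card.
apply/subsetP => y; rewrite !inE => /andP[].
case/existsP => x /andP[]; rewrite inE => /KP[[K1 L1] /and3P[/= _ K1A _] ->].
move=> /forall_inP yx /existsP[z /andP[]].
rewrite inE => /KP[[K2 L2] /and3P[/= KL2 _ L2B] Kz] /forall_inP yz.
rewrite -swap_flip //; apply/andP; split.
  apply: inc K1A _ => // i iK xi; apply/eqP/yx.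
  by apply/imsetP; exists i; rewrite ?inE ?iK.
apply: inc L2B _ => // i iL zi; apply/eqP/yz; rewrite Kz inE.
apply/imsetP => -[i']; rewrite inE => /andP[iK' zi'] e.
(* i' certifies A and i certifies B for the same z, so i' <> i; then i' = pi i,
   and the pair {i, i'} would carry two ones. *)
have : i' \in [set i; pi i] by rewrite e set21.
case/set2P => e'; first by move: (disjointFr KL2 iK'); rewrite e' iL.
have zpi : pairing b (swap pi z u) pi by rewrite pairing_swap.
have [_ _ ne] := pairingP _ _ _ zpi.
case: (eqVneq (pi i) i) => [pii | /ne].
  by move: (disjointFr KL2 iK'); rewrite e' pii iL.
by rewrite zi -e' zi'.
Qed.

(** * The inequality for block-constrained product weights *)

(** A pair (u, v) is replaced by the uniform average over the pairings pi of u
    with relabel u pi = v. *)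
Lemma sum_over_pairings (R : numFieldType) (T : finType) (L : eqType)
    (b : T -> L) (F : {ffun T -> bool} -> {ffun T -> bool} -> R) :
  (forall u v, npairings b u v = 0%N -> F u v = 0) ->
  \sum_u \sum_v F u v =
  \sum_pi \sum_(u | pairing b u pi)
    F u (relabel u pi) / (npairings b u (relabel u pi))%:R.
Proof.
move=> F0; rewrite [RHS](exchange_big_dep predT) //=; apply: eq_bigr => u _.
rewrite (partition_big (relabel u) predT) //=; apply: eq_bigr => v _.
rewrite (eq_bigr (fun=> F u v / (npairings b u v)%:R)); last first.
  by move=> pi /andP[_ /eqP ->].
rewrite sumr_const.
have -> : #|[pred pi | pairing b u pi & relabel u pi == v]| = npairings b u v.
  by apply: eq_card => pi; rewrite !inE.
have [n0 | n0] := eqVneq (npairings b u v) 0%N.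
  by rewrite F0 // mul0r mul0rn.
by rewrite -[RHS]mulr_natr divfK // pnatr_eq0.
Qed.

(** For fixed pi and x the exchange is an involution of the configurations
    paired by pi. *)
Lemma sum_swaps (R : numFieldType) (T : finType) (L : eqType) (b : T -> L)
    (pi : {ffun T -> T}) (h : {ffun T -> bool} -> R) :
  \sum_(u | pairing b u pi) \sum_x h (swap pi x u) =
  (\sum_(u | pairing b u pi) h u) *+ #|{ffun {set T} -> bool}|.
Proof.
case: (pickP (fun u => pairing b u pi)) => [u0 /pairingP[piK _ _] | none].
  rewrite exchange_big /= -sumr_const; apply: eq_bigr => x _.
  rewrite [RHS](reindex_inj (inv_inj (swapK x piK))).
  by apply: eq_bigl => u; rewrite pairing_swap.
by rewrite !big_pred0 // mul0rn.
Qed.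

Section Blocks.
Variables (R : numFieldType) (n : nat) (L : finType) (b : 'I_n -> L).
Variables (k : L -> nat) (w : 'I_n -> R).
Hypothesis w0 : forall i, 0 <= w i.

(** The common unnormalized form of the measures: prescribed numbers of ones in
    the fibres of b, and a product weight. *)
Definition block_weight (u : cube n) : R :=
  [forall j, ones b u j == k j]%:R * \prod_i w i ^+ u i.

Lemma block_weight_ge0 u : 0 <= block_weight u.
Proof.
by rewrite mulr_ge0 ?ler0n // prodr_ge0 // => i _; rewrite exprn_ge0.
Qed.

(** The product weight of a pair (u, v) only depends on the unordered pair
    {u i, v i} at each i, which an exchange preserves. *)
Lemma block_weight_swap pi x u : pairing b u pi ->
  block_weight (swap pi x u) * block_weight (relabel (swap pi x u) pi)
  = block_weight u * block_weight (relabel u pi).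
Proof.
case/pairingP => piK bpi _; rewrite /block_weight.
have onesE (v : cube n) (tau : {ffun 'I_n -> 'I_n}) :
    involutive tau -> (forall i, b (tau i) = b i) ->
    [forall j, ones b (relabel v tau) j == k j] = [forall j, ones b v j == k j].
  by move=> tauK btau; apply: eq_forallb => j; rewrite ones_relabel.
have tauK := pair_swapK x piK.
have btau i : b (pair_swap pi x i) = b i by apply: b_pair_swap.
rewrite relabel_swap // /swap.
rewrite (onesE u _ tauK btau) (onesE (relabel u pi) _ tauK btau).
rewrite [LHS]mulrACA [RHS]mulrACA; congr (_ * _).
rewrite -!big_split /=; apply: eq_bigr => i _.
rewrite !relabelE [pair_swap pi x i]ffunE; case: ifP => _ //.
by rewrite piK mulrC.
Qed.

Lemma block_weight_npairings0 u v : npairings b u v = 0%N ->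
  block_weight u * block_weight v = 0.
Proof.
move=> uv0; rewrite /block_weight.
have [/forallP ku|] := boolP [forall j, ones b u j == k j]; last first.
  by rewrite !mul0r.
have [/forallP kv|] := boolP [forall j, ones b v j == k j]; last first.
  by rewrite mul0r mulr0.
have /npairings_gt0 : ones b u =1 ones b v.
  by move=> j; rewrite (eqP (ku j)) (eqP (kv j)).
by rewrite uv0.
Qed.

(** The inequality for the unnormalized weight; after passing to sums over
    pairings and averaging over exchanges it is box_swap_bound, multiplied by
    the constant weight g of an orbit. *)
Theorem block_weight_box A B : increasing A -> increasing B ->
  (\sum_(u in box A B) block_weight u) * (\sum_v block_weight v) <=
  (\sum_(u in A) block_weight u) * (\sum_(v in B) block_weight v).
Proof.
move=> Ainc Binc; rewrite !(big_mkcond (fun u => u \in _)) !big_distrlr /=.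
rewrite !(sum_over_pairings (b := b)); first last.
- by move=> u v /block_weight_npairings0 uv0; case: ifP; rewrite ?mul0r.
- move=> u v /block_weight_npairings0 uv0.
  by case: ifP; case: ifP; rewrite ?mulr0 ?mul0r.
apply: ler_sum => pi _.
have c_gt0 : (0 < #|{ffun {set 'I_n} -> bool}|)%N.
  by apply/card_gt0P; exists [ffun=> true].
rewrite -(ler_pMn2r c_gt0) -!sum_swaps; apply: ler_sum => u upi.
have [piK bpi _] := pairingP _ _ _ upi.
pose g := block_weight u * block_weight (relabel u pi) /
  (npairings b u (relabel u pi))%:R.
have g0 : 0 <= g.
  by apply: divr_ge0; rewrite ?ler0n // mulr_ge0 // block_weight_ge0.
have np x : npairings b (swap pi x u) (relabel (swap pi x u) pi)
            = npairings b u (relabel u pi).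
  rewrite relabel_swap // npairings_relabel //; first exact: pair_swapK.
  by move=> i; apply: b_pair_swap.
have gE x :
    block_weight (swap pi x u) * block_weight (relabel (swap pi x u) pi) /
    (npairings b (swap pi x u) (relabel (swap pi x u) pi))%:R = g.
  by rewrite np block_weight_swap.
rewrite (eq_bigr (fun x => if x \in [set x | swap pi x u \in box A B]
                           then g else 0)); last first.
  by move=> x _; rewrite inE; case: ifP; rewrite ?gE ?mul0r.
rewrite [leRHS](eq_bigr (fun x =>
   if x \in [set x | swap pi x u \in A & relabel (swap pi x u) pi \in B]
   then g else 0)); last first.
  move=> x _; rewrite inE.
  by case: ifP; case: ifP; rewrite ?gE ?mulr0 ?mul0r.
rewrite -!big_mkcond !sumr_const; apply: ler_wpMn2l => //.
exact: box_swap_bound upi.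
Qed.

End Blocks.

(** * Products of weighted k-out-of-n measures *)

(** The unweighted measure has weights equal to 1. *)
Lemma k_out_of_n_weight (R : realType) n (mu : prob R (cube n)) :
  is_k_out_of_n mu \/ is_weighted_k_out_of_n mu ->
  exists kwc : nat * ('I_n -> R) * R,
    [/\ forall i, 0 <= kwc.1.2 i, 0 <= kwc.2
      & forall u, mu u = kwc.2 * weight kwc.1.1 kwc.1.2 u].
Proof.
case=> [[k [kn muE]] | [k [w [w0 [wk [_ muE]]]]]].
  exists (k, fun=> 1, #|Omega k n|%:R^-1); split=> //= [|u].
    by rewrite invr_ge0 ler0n.
  rewrite muE /= /k_out_of_n_pmf /weight big1 ?mulr1 1?mulrC // => i _.
  exact: expr1n.
exists (k, w, (\sum_u weight k w u)^-1); split=> //=.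
by rewrite invr_ge0 sumr_ge0 // => u _; apply: weight_ge0.
Qed.

Lemma product_block_weight (R : realType) l (n : 'I_l -> nat) (k : 'I_l -> nat)
    (w : forall j, 'I_(n j) -> R) (u : cube (\sum_(j < l) n j)) :
  \prod_j weight (k j) (w j) (block j u) =
  block_weight (@tagnat.sig1 l n) k (fun s => w _ (tagnat.sig2 s)) u.
Proof.
rewrite /weight /block_weight big_split /=; congr (_ * _).
  have E j : (block j u \in Omega (k j) (n j)) =
      (ones (@tagnat.sig1 l n) u j == k j).
    rewrite inE /ones; congr (_ == _).
    have Rinj : injective (@tagnat.Rank l n j).
      by move=> i i' /tagnat.rank_inj/eqP; rewrite eq_Tagged => /eqP.
    rewrite -(card_imset _ Rinj); apply: eq_card => s; rewrite !inE.
    apply/imsetP/andP => [[i] | [/eqP sj us]].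
      by rewrite inE ffunE => ui ->; rewrite tagnat.Rank1K.
    by case: _ / sj; exists (tagnat.sig2 s); rewrite ?inE ?ffunE tagnat.sig2K.
  case: (boolP [forall j, _]) => [/forallP h | /forallPn[j hj]].
    by rewrite big1 // => j _; rewrite E h.
  by rewrite (bigD1 j) //= E (negPf hj) mul0r.
rewrite (@sig_big_dep _ _ _ _ (fun j => 'I_(n j)) predT (fun _ => predT)
  (fun j i => w j i ^+ (block j u) i)) /=.
rewrite (reindex (@tagnat.sig l n)) /=; last exact/onW_bij/tagnat.sig_bij.
apply: eq_bigr => s _; rewrite ffunE; congr (_ ^+ nat_of_bool (u _)).
exact: tagnat.sig2K.
Qed.

Theorem mainTheorem3 (R : realType) (l : nat) (l_ge1 : (1 <= l)%N)
    (n : 'I_l -> nat) (n_gt0 : forall j, (0 < n j)%N)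
    (mu : forall j : 'I_l, prob R (cube (n j)))
    (mu_kn : forall j, is_k_out_of_n (mu j) \/ is_weighted_k_out_of_n (mu j))
    (A B : {set cube (\sum_(j < l) n j)})
    (A_incr : increasing A) (B_incr : increasing B) :
  Pr (product mu) (box A B) <= Pr (product mu) A * Pr (product mu) B.
Proof.
have [p pP] := fin_all_exists (fun j => k_out_of_n_weight (mu_kn j)).
pose C := \prod_j (p j).2.
pose m := block_weight (@tagnat.sig1 l n) (fun j => (p j).1.1)
  (fun s => (p _).1.2 (tagnat.sig2 s)).
have muE u : product mu u = C * m u.
  rewrite /m -(product_block_weight (fun j => (p j).1.1) (fun j => (p j).1.2)).
  by rewrite /C -big_split; apply: eq_bigr => j _; have [_ _ ->] := pP j.
have C0 : 0 <= C by apply: prodr_ge0 => j _; have [] := pP j.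
have PrE E : Pr (product mu) E = C * \sum_(u in E) m u.
  by rewrite /Pr mulr_sumr; apply: eq_bigr => u _; rewrite muE.
have total : C * \sum_u m u = 1.
  by rewrite mulr_sumr -(pmf_sum1 (product mu)); apply: eq_bigr => u _;
    rewrite muE.
rewrite -[leLHS]mulr1 -total !PrE [leLHS]mulrACA [leRHS]mulrACA.
rewrite ler_wpM2l ?mulr_ge0 //.
by apply: block_weight_box => // s; have [] := pP (tagnat.sig1 s).
Qed.
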